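(* Let $A=\{x_1,x_2\}$ be an alphabet of two variables. For every positive integer $n$, $$\sum_{\substack{0\le k\le n\\ k\equiv n\ (\mathrm{mod}\ 2)}}\binom{n}{k}(x_1-x_2)^{n-k}\left(2^k\phi_k(x_1+x_2)+2(x_1+x_2)^k\right)G_{n-k}=-n2^{n-1}(x_1-x_2)^2S_{n-2}(x_1+x_2).$$
   Context: Here $x_1,x_2$ are two commuting variables (indeterminates) and identities are in the field of rational functions in them. The notation $S_n(x_1+x_2)$, $\phi_n(x_1+x_2)$ denotes functions of the alphabet $\{x_1,x_2\}$ (not functions of the sum): $S_n(x_1+x_2)=\dfrac{x_1^{n+1}-x_2^{n+1}}{x_1-x_2}$ for $n\ge 0$, with $S_n(x_1+x_2)=0$ for $n<0$, and $\phi_n(x_1+x_2)=x_1^n+x_2^n$ for $n\ge 0$. The expression $(x_1+x_2)^k$ is the ordinary power of the sum. The Genocchi numbers $G_n$ are defined by $\sum_{n\ge 0}G_n\frac{z^n}{n!}=\frac{2z}{e^z+1}$. *)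

(* Defs.v *)
From HB Require Import structures.
From mathcomp Require Import all_boot all_order all_algebra.

Set Implicit Arguments.
Unset Strict Implicit.
Unset Printing Implicit Defensive.

Import GRing.Theory.
Local Open Scope ring_scope.

(* A formal power series over F is represented by its coefficients. *)
Section PowerSeries.
Variable F : fieldType.
Implicit Types a b c : nat -> F.

Definition ps_mul a b : nat -> F :=
  fun n => \sum_(i < n.+1) a i * b (n - i)%N.

(* The coefficients [:: b_n; ...; b_0] of the inverse b of a, obtained from
   a_0 * b_(m+1) = - (a_1 * b_m + ... + a_(m+1) * b_0). *)
Fixpoint ps_inv_rev a (n : nat) : seq F :=
  if n is m.+1 then
    let s := ps_inv_rev a m in
    (- ((a 0)^-1 * \sum_(i < m.+1) a i.+1 * s`_i)) :: s
  else [:: (a 0)^-1].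

(* Meaningful only for a 0 != 0. *)
Definition ps_inv a : nat -> F := fun n => (ps_inv_rev a n)`_0.

Definition ps_div a b : nat -> F := ps_mul a (ps_inv b).

Lemma nth_ps_inv_rev a n i : (i <= n)%N ->
  (ps_inv_rev a n)`_i = ps_inv a (n - i).
Proof.
elim: n i => [|n IHn] [|i] // lein.
by rewrite [ps_inv_rev a n.+1]/= /= IHn // subSS.
Qed.

Lemma ps_mulV a n : a 0 != 0 -> ps_mul a (ps_inv a) n = (n == 0)%:R.
Proof.
move=> a0; rewrite /ps_mul big_ord_recl subn0.
case: n => [|n]; first by rewrite big_ord0 addr0 mulfV.
rewrite {1}/ps_inv [ps_inv_rev a n.+1]/= [nth _ _ _]/=.
rewrite mulrN mulVKf // -sumrN -big_split big1 // => i _ /=.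
by rewrite subSS nth_ps_inv_rev ?addNr // -ltnS.
Qed.

Lemma ps_mulE N a b n : (n < N)%N ->
  ps_mul a b n = (\poly_(i < N) a i * \poly_(i < N) b i)`_n.
Proof.
move=> ltnN; rewrite coefM; apply: eq_bigr => i _.
have lein : (i <= n)%N by rewrite -ltnS.
by rewrite !coef_poly (leq_ltn_trans lein) // (leq_ltn_trans _ ltnN) ?leq_subr.
Qed.

Lemma ps_mulC a b n : ps_mul a b n = ps_mul b a n.
Proof. by rewrite !(@ps_mulE n.+1) // mulrC. Qed.

Lemma ps_mulA a b c n : ps_mul a (ps_mul b c) n = ps_mul (ps_mul a b) c n.
Proof.
pose p (d : nat -> F) := \poly_(i < n.+1) d i.
transitivity ((p a * (p b * p c))`_n).
  rewrite coefM; apply: eq_bigr => i _.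
  by rewrite coef_poly ltn_ord -ps_mulE // ltnS leq_subr.
rewrite mulrA coefM; apply: eq_bigr => i _.
by rewrite coef_poly ltnS leq_subr -ps_mulE.
Qed.

Lemma ps_mul1 a n : ps_mul a (fun i => (i == 0)%:R) n = a n.
Proof.
rewrite /ps_mul big_ord_recr /= subnn mulr1 big1 ?add0r // => i _.
by rewrite subn_eq0 leqNgt ltn_ord mulr0.
Qed.

Lemma ps_divK a b n : b 0 != 0 -> ps_mul (ps_div a b) b n = a n.
Proof.
move=> b0; rewrite -ps_mulA -[RHS]ps_mul1.
by apply: eq_bigr => i _; rewrite ps_mulC ps_mulV.
Qed.

End PowerSeries.

Definition ps_2z : nat -> rat := fun n => if n == 1 then 2 else 0.

Definition ps_exp_add1 : nat -> rat := fun n => n`!%:R^-1 + (n == 0)%:R.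

Definition genocchi (n : nat) : rat := n`!%:R * ps_div ps_2z ps_exp_add1 n.

Lemma genocchi_gen n :
  ps_mul (fun m => genocchi m / m`!%:R) ps_exp_add1 n = ps_2z n.
Proof.
rewrite -(@ps_divK _ ps_2z ps_exp_add1) //; apply: eq_bigr => i _.
congr (_ * _); rewrite /genocchi mulrAC mulfV ?mul1r //.
by rewrite Num.Theory.pnatr_eq0 -lt0n fact_gt0.
Qed.

(* The functions S_m and phi_m of the alphabet {x1, x2}; S_m is indexed by an
   integer and vanishes for m < 0. *)
Section Alphabet.
Variables (F : fieldType) (x1 x2 : F).

Definition complete_sym (m : int) : F :=
  if m is Posz k then (x1 ^+ k.+1 - x2 ^+ k.+1) / (x1 - x2) else 0.

Definition power_sum (k : nat) : F := x1 ^+ k + x2 ^+ k.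

End Alphabet.

(* Main.v *)
(* Put d = x1 - x2 and s = x1 + x2.  Since G(z) = 2z/(e^z + 1) satisfies
   G(z) - G(-z) = 2z, its even part is E(z) = G(z) - z, and
   E(z) (e^z + 1) = z (1 - e^z).  The left-hand side is n! times the
   coefficient of z^n in
     E(dz) (e^(2 x1 z) + e^(2 x2 z) + 2 e^(sz))
       = E(dz) (e^(dz) + 1) (e^(sz) + e^(2 x2 z))
       = dz (1 - e^(dz)) (e^(sz) + e^(2 x2 z))
       = dz (e^(2 x2 z) - e^(2 x1 z)),
   because s = d + 2 x2 and 2 x1 = d + s. *)

Require Import Defs.
From mathcomp Require Import all_boot all_order all_algebra.
From mathcomp Require Import mpoly.
From mathcomp Require Import ring.

Local Open Scope ring_scope.

Import GRing.Theory.

(** * Rational numbers inside a field of characteristic zero *)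

Section RatrChar0.
Set Implicit Arguments.
Unset Strict Implicit.
Variable F : fieldType.
Hypothesis charF0 : [pchar F] =i pred0.

Lemma intr_neq0_pchar0 (m : int) : m != 0 -> m%:~R != 0 :> F.
Proof.
move=> m0; have nz k : k != 0%N -> k%:R != 0 :> F.
  by move/pcharf0P: charF0 => ->.
case: m m0 => k k0; first exact: nz.
by rewrite NegzE rmorphN oppr_eq0; exact: nz.
Qed.

Let denq_neq0F (x : rat) : (denq x)%:~R != 0 :> F.
Proof. by rewrite intr_neq0_pchar0 ?denq_neq0. Qed.

Let denqM_neq0F (x y : rat) : (denq x * denq y)%:~R != 0 :> F.
Proof. by rewrite intr_neq0_pchar0 // mulf_neq0 ?denq_neq0. Qed.

Lemma ratrD_pchar0 : {morph (@ratr F) : x y / x + y}.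
Proof.
move=> x y; rewrite /ratr addf_div // -!intrM -intrD.
apply/eqP; rewrite eqr_div // -?intrM; apply/eqP.
(* After cross-multiplication only an equation in [int] is left; it is checked in [rat], where
   [numq x] is [x * denq x]. *)
congr _%:~R; apply: (intr_inj (R := rat)); rewrite !(intrM, intrD) !numqE.
by ring.
Qed.

Lemma ratrM_pchar0 : {morph (@ratr F) : x y / x * y}.
Proof.
move=> x y; rewrite /ratr mulf_div -!intrM.
apply/eqP; rewrite eqr_div // -?intrM; apply/eqP.
congr _%:~R; apply: (intr_inj (R := rat)); rewrite !intrM !numqE.
by ring.
Qed.

Lemma ratrV_pchar0 (x : rat) : ratr x^-1 = (ratr x)^-1 :> F.
Proof.
have [->|x0] := eqVneq x 0; first by rewrite invr0 (ratr_nat _ 0) invr0.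
have h : ratr x^-1 * ratr x = 1 :> F.
  by rewrite -ratrM_pchar0 mulVf // (ratr_nat _ 1).
have rx0 : ratr x != 0 :> F.
  by apply: contra_eq_neq h => ->; rewrite mulr0 eq_sym oner_neq0.
by apply: (mulIf rx0); rewrite h mulVf.
Qed.

Lemma ratr_sum_pchar0 n (f : 'I_n -> rat) :
  ratr (\sum_i f i) = \sum_i ratr (f i) :> F.
Proof. exact: (big_morph _ ratrD_pchar0 (ratr_nat _ 0)). Qed.

End RatrChar0.

(** * Algebra of power series given by their coefficients *)

Section PowerSeriesTheory.
Set Implicit Arguments.
Unset Strict Implicit.
Variable F : fieldType.
Implicit Types a b c : nat -> F.

Lemma eq_ps_mul a a' b b' : a =1 a' -> b =1 b' -> ps_mul a b =1 ps_mul a' b'.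
Proof. by move=> eqa eqb n; apply: eq_bigr => i _; rewrite eqa eqb. Qed.

Lemma ps_mulDl a b c n :
  ps_mul (fun i => a i + b i) c n = ps_mul a c n + ps_mul b c n.
Proof. by rewrite -big_split; apply: eq_bigr => i _; rewrite mulrDl. Qed.

Lemma ps_mulBl a b c n :
  ps_mul (fun i => a i - b i) c n = ps_mul a c n - ps_mul b c n.
Proof. by rewrite -sumrB; apply: eq_bigr => i _; rewrite mulrBl. Qed.

Lemma ps_mulDr a b c n :
  ps_mul c (fun i => a i + b i) n = ps_mul c a n + ps_mul c b n.
Proof. by rewrite -big_split; apply: eq_bigr => i _; rewrite mulrDr. Qed.

Lemma ps_mul1l a n : ps_mul (fun i => (i == 0)%:R) a n = a n.
Proof. by rewrite ps_mulC ps_mul1. Qed.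

(** A nonzero constant term makes [c] invertible, so every [d] is recovered from [d c] by
    multiplying with [ps_inv c]. *)
Lemma ps_mulI c a b : c 0 != 0 -> ps_mul a c =1 ps_mul b c -> a =1 b.
Proof.
move=> c0 eqab n.
have inv d : d n = ps_mul (ps_mul d c) (ps_inv c) n.
  rewrite -ps_mulA -[LHS]ps_mul1; apply: eq_ps_mul => // i.
  by rewrite ps_mulV.
by rewrite [LHS]inv [RHS]inv; apply: eq_ps_mul.
Qed.

(** The substitution of [r z] for [z] is multiplicative. *)
Lemma ps_mul_scale (r : F) a b n :
  ps_mul (fun i => r ^+ i * a i) (fun i => r ^+ i * b i) n
  = r ^+ n * ps_mul a b n.
Proof.
rewrite /ps_mul mulr_sumr; apply: eq_bigr => i _.
by rewrite mulrACA -exprD subnKC // -ltnS.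
Qed.

Definition ps_monomial (r : F) : nat -> F := fun n => if n == 1 then r else 0.

Lemma ps_mul_monomial (r : F) a n : ps_mul (ps_monomial r) a n.+1 = r * a n.
Proof.
rewrite /ps_mul big_ord_recl mul0r add0r big_ord_recl /= subSS subn0.
by rewrite big1 ?addr0 // => i _; rewrite mul0r.
Qed.

End PowerSeriesTheory.

(** * Exponential and Genocchi series, and the identity over any field of characteristic zero *)

Section Genocchi.
Set Implicit Arguments.
Unset Strict Implicit.
Variable F : fieldType.
Hypothesis charF0 : [pchar F] =i pred0.
Implicit Types (x y d : F) (n : nat).

Lemma natf_neq0_pchar0 n : (0 < n)%N -> n%:R != 0 :> F.
Proof. by rewrite lt0n; move/pcharf0P: charF0 => ->. Qed.

Let fact_neq0 n : n`!%:R != 0 :> F.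
Proof. by rewrite natf_neq0_pchar0 ?fact_gt0. Qed.

(** Turns products of exponential series into binomial convolutions. *)
Lemma invf_fact_mul n i : (i <= n)%N ->
  i`!%:R^-1 * (n - i)`!%:R^-1 = 'C(n, i)%:R / n`!%:R :> F.
Proof.
move=> lein; rewrite -(bin_fact lein) !natrM !invfM mulVKf //.
by rewrite natf_neq0_pchar0 ?bin_gt0.
Qed.

Definition ps_exp x : nat -> F := fun n => x ^+ n / n`!%:R.

Lemma ps_mul_exp x y n : ps_mul (ps_exp x) (ps_exp y) n = ps_exp (x + y) n.
Proof.
rewrite /ps_exp addrC exprDn mulr_suml; apply: eq_bigr => i _.
have lein : (i <= n)%N by rewrite -ltnS.
by rewrite mulrACA invf_fact_mul // mulrA mulr_natr [x ^+ i * _]mulrC.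
Qed.

Definition ps_genocchi : nat -> F := fun n => ratr (genocchi n) / n`!%:R.

Definition ps_one : nat -> F := fun n => (n == 0)%:R.

Definition ps_exp1 x : nat -> F := fun n => ps_exp x n + ps_one n.

Lemma ps_genocchi_gen : ps_mul ps_genocchi (ps_exp1 1) =1 ps_monomial 2.
Proof.
move=> n; have -> : ps_monomial 2 n = ratr (ps_2z n) :> F.
  rewrite /ps_monomial /ps_2z.
  by case: eqP; rewrite (ratr_nat _ 2, ratr_nat _ 0).
rewrite -genocchi_gen /ps_mul ratr_sum_pchar0 //; apply: eq_bigr => i _.
rewrite /ps_genocchi /ps_exp1 /ps_exp /ps_one /ps_exp_add1.
rewrite !(ratrM_pchar0, ratrD_pchar0, ratrV_pchar0) // !ratr_nat.
by rewrite expr1n mul1r.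
Qed.

Lemma ps_genocchi_scale_gen d :
  ps_mul (fun n => d ^+ n * ps_genocchi n) (ps_exp1 d) =1 ps_monomial (2 * d).
Proof.
move=> n; transitivity (d ^+ n * ps_monomial 2 n).
  rewrite -ps_genocchi_gen -ps_mul_scale; apply: eq_ps_mul => // i.
  rewrite /ps_exp1 /ps_exp /ps_one expr1n mulrDr mul1r.
  (* The summand 1 of [e^z + 1] is unchanged by scaling: it lives in degree 0, where [d ^+ 0] is
     1. *)
  by case: i => [|i]; rewrite ?expr0 ?mul1r ?mulr0.
by case: n => [|[|n]]; rewrite /ps_monomial ?mulr0 // expr1 mulrC.
Qed.

(** This is [G(-z) = G(z) - 2z]. Multiplied by [e^z + 1 = (e^(-z) + 1) e^z], the left side becomes
    [-2z e^z] and the right side [2z - 2z (e^z + 1)]. *)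
Lemma ps_genocchiN n :
  (-1) ^+ n * ps_genocchi n = ps_genocchi n - ps_monomial 2 n.
Proof.
move: n; apply: (@ps_mulI _ (ps_exp1 1)).
  by rewrite /ps_exp1 /ps_exp /ps_one expr0 divr1; exact: (@natf_neq0_pchar0 2).
move=> n; rewrite ps_mulBl ps_genocchi_gen.
have expE : ps_exp1 1 =1 ps_mul (ps_exp1 (-1)) (ps_exp 1).
  move=> i; rewrite ps_mulDl ps_mul1l ps_mul_exp addNr addrC; congr (_ + _).
  by rewrite /ps_exp /ps_one expr0n; case: i => [|i]; rewrite ?divr1 ?mul0r.
rewrite (eq_ps_mul (frefl _) expE) ps_mulA.
rewrite (eq_ps_mul (ps_genocchi_scale_gen (-1)) (frefl _)).
rewrite ps_mulDr ps_mul1; case: n => [|n].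
  by rewrite /ps_mul !big_ord1 !mul0r addr0 subr0.
by rewrite !ps_mul_monomial; ring.
Qed.

(** For odd [n], [ps_genocchiN] says that twice the right-hand side is 0; for even [n] the monomial,
    which sits in degree 1, contributes nothing. *)
Lemma ps_genocchi_even n :
  (if odd n then 0 else ps_genocchi n) = ps_genocchi n - ps_monomial 1 n.
Proof.
have two0 : 2 != 0 :> F by exact: natf_neq0_pchar0.
have := ps_genocchiN n; rewrite -signr_odd; case: ifP => [odd_n|even_n] /=.
  rewrite expr1 mulN1r => h; apply: (mulfI two0).
  have -> : 2 * (ps_genocchi n - ps_monomial 1 n)
           = ps_genocchi n + (ps_genocchi n - ps_monomial 2 n).
    by rewrite /ps_monomial; case: eqP => _; ring.
  by rewrite -h subrr mulr0.
rewrite /ps_monomial.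
by case: eqP => [n1|]; [rewrite n1 in even_n | rewrite subr0].
Qed.

(** The series [E(dz)], with the parity test that matches the congruence restricting the sum. *)
Definition ps_genocchi_even_scale d : nat -> F :=
  fun n => if odd n then 0 else d ^+ n * ps_genocchi n.

Lemma ps_genocchi_even_scale_gen d :
  ps_mul (ps_genocchi_even_scale d) (ps_exp1 d)
    =1 ps_mul (ps_monomial d) (fun n => ps_one n - ps_exp d n).
Proof.
have evE : ps_genocchi_even_scale d
    =1 (fun n => d ^+ n * ps_genocchi n - ps_monomial d n).
  move=> n; rewrite /ps_genocchi_even_scale.
  transitivity (d ^+ n * (ps_genocchi n - ps_monomial 1 n)).
    by rewrite -ps_genocchi_even; case: odd; rewrite ?mulr0.
  rewrite mulrBr /ps_monomial; congr (_ - _).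
  by case: eqP => [->|_]; rewrite ?mulr0 ?mulr1.
move=> n; rewrite (eq_ps_mul evE (frefl _)) ps_mulBl ps_genocchi_scale_gen.
case: n => [|n]; first by rewrite /ps_mul !big_ord1 !mul0r subr0.
rewrite !ps_mul_monomial /ps_monomial /ps_exp1 /ps_one eqSS.
by case: eqP => _; rewrite /=; ring.
Qed.

Lemma ps_genocchi_even_alphabet x1 x2 n :
  ps_mul
    (fun i => ps_exp (2 * x1) i + ps_exp (2 * x2) i + 2 * ps_exp (x1 + x2) i)
    (ps_genocchi_even_scale (x1 - x2)) n
  = ps_mul (ps_monomial (x1 - x2))
      (fun i => ps_exp (2 * x2) i - ps_exp (2 * x1) i) n.
Proof.
(* [w] is the cofactor of [e^(dz) + 1] in the sum of exponentials. *)
set d := x1 - x2; pose w i := ps_exp (x1 + x2) i + ps_exp (2 * x2) i.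
have ds : d + (x1 + x2) = 2 * x1 by rewrite /d; ring.
have d2 : d + 2 * x2 = x1 + x2 by rewrite /d; ring.
transitivity (ps_mul (ps_genocchi_even_scale d) (ps_mul (ps_exp1 d) w) n).
  rewrite ps_mulC; apply: eq_ps_mul => // i.
  by rewrite ps_mulDl ps_mul1l ps_mulDr !ps_mul_exp ds d2 /w; ring.
rewrite ps_mulA (eq_ps_mul (ps_genocchi_even_scale_gen d) (frefl _)) -ps_mulA.
apply: eq_ps_mul => // i.
by rewrite ps_mulBl ps_mul1l ps_mulDr !ps_mul_exp ds d2 /w; ring.
Qed.

(** Compares coefficients in [ps_genocchi_even_alphabet], multiplied by the factorial of [n]. The
    elements [x1] and [x2] are arbitrary and may coincide. *)
Lemma genocchi_alphabet x1 x2 n : (0 < n)%N ->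
  \sum_(0 <= k < n.+1 | k == n %[mod 2])
     'C(n, k)%:R * (x1 - x2) ^+ (n - k)
       * (2 ^+ k * power_sum x1 x2 k + 2 * (x1 + x2) ^+ k)
       * ratr (genocchi (n - k))
  = - (n%:R * 2 ^+ (n - 1) * (x1 - x2) ^+ 2 * complete_sym x1 x2 (n%:Z - 2)).
Proof.
case: n => // n _; rewrite subn1 [n.+1.-1]/=.
transitivity (n.+1`!%:R * ps_mul
  (fun i => ps_exp (2 * x1) i + ps_exp (2 * x2) i + 2 * ps_exp (x1 + x2) i)
  (ps_genocchi_even_scale (x1 - x2)) n.+1).
  rewrite big_mkcond big_mkord mulr_sumr; apply: eq_bigr => i _ /=.
  have lein : (i <= n.+1)%N by rewrite -ltnS.
  (* The congruence modulo 2 becomes evenness of the index of the Genocchi number. *)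
  rewrite eq_sym eqn_mod_dvd // dvdn2 /ps_genocchi_even_scale.
  case: odd => /=; first by rewrite !mulr0.
  rewrite /ps_exp /ps_genocchi /power_sum !exprMn.
  transitivity (n.+1`!%:R * ('C(n.+1, i)%:R / n.+1`!%:R)
    * (x1 - x2) ^+ (n.+1 - i)
    * (2 ^+ i * (x1 ^+ i + x2 ^+ i) + 2 * (x1 + x2) ^+ i)
    * ratr (genocchi (n.+1 - i))).
    by rewrite [_ / _]mulrC mulVKf.
  by rewrite -invf_fact_mul //; ring.
rewrite ps_genocchi_even_alphabet ps_mul_monomial /ps_exp factS natrM.
have -> : n.+1%:R * n`!%:R
    * ((x1 - x2) * ((2 * x2) ^+ n / n`!%:R - (2 * x1) ^+ n / n`!%:R))
  = - (n.+1%:R * 2 ^+ n * ((x1 - x2) * (x1 ^+ n - x2 ^+ n))).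
  by rewrite !exprMn; field.
rewrite -[in RHS]mulrA; congr (- (_ * _)).
(* Here the index of the theorem is 1: [complete_sym] is taken at -1, where it is 0, and on the left
   the two zeroth powers cancel. *)
case: n => [|n]; first by rewrite !expr0 subrr !mulr0.
have -> : n.+2%:Z - 2 = n by rewrite -[n.+2]addn2 PoszD addrK.
(* If [x1 = x2] the quotient is no true division, but both sides carry a factor [x1 - x2] and
   vanish. *)
rewrite /complete_sym; have [->|d0] := eqVneq (x1 - x2) 0.
  by rewrite expr2 !mul0r.
by rewrite expr2 -mulrA [_ * (_ / _)]mulrC divfK.
Qed.

End Genocchi.

(** * Specialization to the field of rational functions *)

Lemma pchar_fraction (R : idomainType) : [pchar {fraction R}] =i [pchar R].
Proof.
move=> p; rewrite !inE; congr (_ && _).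
by rewrite -(rmorph_nat (@tofrac R)) tofrac_eq0.
Qed.

Theorem theorem3 (K : fieldType) (charK0 : [pchar K] =i pred0)
    (n : nat) (n_gt0 : (0 < n)%N) :
  let x1 : {fraction {mpoly K[2]}} := tofrac 'X_ord0 in
  let x2 : {fraction {mpoly K[2]}} := tofrac 'X_ord_max in
  \sum_(0 <= k < n.+1 | k == n %[mod 2])
     'C(n, k)%:R * (x1 - x2) ^+ (n - k)
       * (2 ^+ k * power_sum x1 x2 k + 2 * (x1 + x2) ^+ k)
       * ratr (genocchi (n - k))
  = - (n%:R * 2 ^+ (n - 1) * (x1 - x2) ^+ 2 * complete_sym x1 x2 (n%:Z - 2)).
Proof.
move=> x1 x2; apply: genocchi_alphabet => // p.
by rewrite pchar_fraction pchar_lalg charK0.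
Qed.
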